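(* Let $k\ge2$ be an integer, $T=\begin{bmatrix}0&-1\\1&2k+1\end{bmatrix}$ and $G=\mathbb{Z}^2\rtimes\langle t\rangle$ the associated torus bundle group. Suppose that $g=(x,t^n)$ is an element of $G$. Then $x$ has an $n$-minimal representative whose polynomial part and principal part are both $n$-reduced.
   Context: $t\,x\,t^{-1}=T\cdot x$ for $x\in\mathbb{Z}^2$; $a=\begin{bmatrix}1\\0\end{bmatrix}$, $b=\begin{bmatrix}0\\1\end{bmatrix}$; elements of $G$ are written $(x,t^n)$; $\|g\|$ is the word length with respect to $\{a,b,t\}$ (inverses allowed). A Laurent polynomial $F(X)\in\mathbb{Z}[X,X^{-1}]$ represents $x$ if $x=F(T)(b)$. Given $n$, write $F(X)=\sum_{j=-p-1}^{q}c_jX^j$ (adding or removing zero terms) so that $p\ge\max\{0,-n\}$ with $c_{-p-1}\neq0$ if $p>\max\{0,-n\}$, and $q\ge\max\{0,n\}$ with $c_q\ne0$ if $q>\max\{0,n\}$. The $n$-length is $L_n(F)=2p+2q-|n|+\sum_{j=-p-1}^{q}|c_j|$. $F$ is an $n$-minimal representative of $x$ if it represents $x$ and $L_n(F)=\|(x,t^n)\|$. The polynomial part of $F$ is $\sum_{j\ge0}c_jX^j$ and the principal part is $\sum_{j<0}c_jX^j$. $n$-reduced polynomials. Let $P=\sum_{i=0}^mc_iX^i\in\mathbb{Z}[X]$ have degree $m$, also written as the word $(c_m,\dots,c_0)$; coefficients with index outside $[0,m]$ are $0$. $\operatorname{sign}$ is the usual sign; $\operatorname{sign}^+(x)=1$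 if $x\ge0$ and $-1$ if $x<0$. $\operatorname{Pot}(c_j,\dots,c_l)=\sum_{s=l}^{j}\bigl((2k-1)-2|c_s|\bigr)$. $P$ is $n$-reduced if the following rules hold (the zero polynomial is $n$-reduced). Rule 1. If $m\ge n$: $|c_m|\le k+2$, and $|c_m|\le k+1$ if $\operatorname{sign}(c_mc_{m-1})<0$. Rule 2. For $i=m<n$ or $i<m$: $|c_i|\le k+1$; $|c_i|\le k$ if $\operatorname{sign}(c_{i+1}c_i)<0$ or $\operatorname{sign}(c_ic_{i-1})<0$; $|c_i|\le k-1$ if $\operatorname{sign}(c_{i+1}c_i)<0$ and $\operatorname{sign}(c_ic_{i-1})<0$. Rule 3. If $m>n$: $(c_m,c_{m-1})\ne\pm(1,-k)$, and $(c_m,c_{m-1})\neq\pm(1,-k+1)$ if $\operatorname{sign}(c_{m-1}c_{m-2})<0$. Rule 4. If $m>n$, $i\ge1$ and $(c_m,\dots,c_{m-i})=\pm(1,c'_{m-1},\dots,c'_{m-i})$ with $c'_{m-1}\in\{-k+1,-k+2\}$, $c'_{m-j}\in\{-k+1,-k\}$ for $1<j<i$, and $c'_{m-i}\in\{-k,-k-1\}$, then $\operatorname{Pot}(c'_{m-1},\dots,c'_{m-i})\ge2$ if $\operatorname{sign}(c_mc_{m-i-1})>0$, and $\operatorname{Pot}(c'_{m-1},\dots,c'_{m-i})>0$ if $\operatorname{sign}(c_mc_{m-i-1})\le0$. Rule 5. If $m\ge n$, $i\ge1$ and $(c_m,\dots,c_{m-i})=\pm(c'_m,\dots,c'_{m-i})$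 with $c'_m\in\{k+1,k+2\}$, $c'_{m-i'}\in\{k-1,k\}$ for $0<i'<i$, and $c'_{m-i}\in\{k,k+1\}$, then $\operatorname{Pot}(c'_m,\dots,c'_{m-i})>-6$ if $\operatorname{sign}(c_mc_{m-i-1})\ge0$, and $\operatorname{Pot}(c'_m,\dots,c'_{m-i})\ge-4$ if $\operatorname{sign}(c_mc_{m-i-1})<0$. Rule 6. If $0\le l<j$ and either $0<j<m$ or $0<j=m<n$, and $(c_j,\dots,c_l)=\pm(c'_j,\dots,c'_l)$ with $c'_j,c'_l\in\{k,k+1\}$ and $c'_s\in\{k-1,k\}$ for $l<s<j$, then $\operatorname{Pot}(c_j,\dots,c_l)>-3-\operatorname{sign}^+(c_jc_{j+1})$ if $\operatorname{sign}(c_jc_{l-1})\ge0$, and $\operatorname{Pot}(c_j,\dots,c_l)\ge-1-\operatorname{sign}^+(c_jc_{j+1})$ if $\operatorname{sign}(c_jc_{l-1})<0$. A principal part $Q(X)\in X^{-1}\mathbb{Z}[X^{-1}]$ of a representative of $(x,t^n)$ is called $n$-reduced if the polynomial $\overline{Q}(X)=X^{-1}Q(X^{-1})\in\mathbb{Z}[X]$ is $(-n)$-reduced, i.e. if $\overline{Q}$ is zero or the coefficients and degree of $P=\overline{Q}$ satisfy Rules 1–6 with $n$ replaced by $-n$ throughout. *)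

(* Defs.v *)
From HB Require Import structures.
From mathcomp Require Import all_boot all_order all_algebra.
From mathcomp Require Import finmap.
From mathcomp Require Import zify.

Set Implicit Arguments.
Unset Strict Implicit.
Unset Printing Implicit Defensive.

Import Order.TTheory GRing.Theory Num.Theory.
Local Open Scope ring_scope.

Definition Tmx (k : int) : 'M[int]_2 :=
  \matrix_(i, j) nth 0 (nth [::] [:: [:: 0; - 1]; [:: 1; 2 * k + 1]] i) j.

Definition avec : 'cV[int]_2 := delta_mx 0 0.
Definition bvec : 'cV[int]_2 := delta_mx 1 0.

(* The carrier of the semidirect product of Z^2 by <t>: the pair (x, n) stands
   for (x, t^n); the group law, with t x t^-1 = T x, is [tb_mul] below. *)
Definition torus_bundle (k : int) : Type := ('cV[int]_2 * int)%type.

Section TorusBundleGroup.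
Context (k : int).
Implicit Types g h : torus_bundle k.

Lemma Tmx_unit : Tmx k \is a GRing.unit.
Proof.
rewrite -[_ \is a _]/(Tmx k \in unitmx) unitmxE.
suff -> : \det (Tmx k) = 1 by rewrite unitr1.
rewrite (expand_det_row _ 0) !big_ord_recl big_ord0 /cofactor !det_mx11.
by rewrite !mxE /= mul0r add0r addr0 mulr1 -[(_ + _)%N]/1%N expr1 mulrNN mulr1.
Qed.

Definition tb_one : torus_bundle k := (0, 0).
Definition tb_mul g h : torus_bundle k :=
  (g.1 + Tmx k ^ g.2 *m h.1, g.2 + h.2).
Definition tb_inv g : torus_bundle k := (- (Tmx k ^ (- g.2) *m g.1), - g.2).

Lemma tb_mulA : associative tb_mul.
Proof.
move=> [x m] [y n] [z p]; rewrite /tb_mul /= mulmxDr !addrA mulmxA.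
by rewrite (exprzDr Tmx_unit).
Qed.

Lemma tb_mul1g : left_id tb_one tb_mul.
Proof. by move=> [x n]; rewrite /tb_mul /= expr0z mul1mx !add0r. Qed.

Lemma tb_mulg1 : right_id tb_one tb_mul.
Proof. by move=> [x n]; rewrite /tb_mul /= mulmx0 !addr0. Qed.

Lemma tb_mulVg : left_inverse tb_one tb_inv tb_mul.
Proof. by move=> [x n]; rewrite /tb_mul /= !addNr. Qed.

Lemma tb_mulgV : right_inverse tb_one tb_inv tb_mul.
Proof.
move=> [x n]; rewrite /tb_mul /= mulmxN mulmxA -[_ *m _ ^ _]/(_ * _).
by rewrite -(exprzDr Tmx_unit) !subrr expr0z mul1mx subrr.
Qed.

HB.instance Definition _ :=
  Choice.copy (torus_bundle k) ('cV[int]_2 * int)%type.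
HB.instance Definition _ := isGroup.Build (torus_bundle k)
  tb_mulA tb_mul1g tb_mulg1 tb_mulVg tb_mulgV.

End TorusBundleGroup.

Section Words.
Context (G : groupType) (S : seq G).

Definition letters : seq G := S ++ [seq s^-1%g | s <- S].

Definition has_word_of_length (g : G) (n : nat) : bool :=
  [exists w : n.-tuple (seq_sub letters), (\prod_(s <- w) val s)%g == g].

Definition word_generated (g : G) : Prop := exists n, has_word_of_length g n.

Lemma word_generated1 : word_generated 1%g.
Proof. by exists 0%N; apply/existsP; exists [tuple]; rewrite big_nil. Qed.

Lemma word_generated_letter g : g \in letters -> word_generated g.
Proof.
by move=> gS; exists 1%N; apply/existsP; exists [tuple SeqSub gS];
  rewrite big_seq1.
Qed.

Lemma word_generatedM g h :
  word_generated g -> word_generated h -> word_generated (g * h)%g.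
Proof.
move=> [m /existsP[u /eqP <-]] [n /existsP[v /eqP <-]].
by exists (m + n)%N; apply/existsP; exists [tuple of u ++ v]; rewrite big_cat.
Qed.

Lemma word_generatedX g n : word_generated g -> word_generated (g ^+ n)%g.
Proof.
move=> gS; elim: n => [|n IHn]; first exact: word_generated1.
by rewrite expgS; apply: word_generatedM.
Qed.

End Words.

Section WordLength.
Context (k : int).

Definition tb_a : torus_bundle k := (avec, 0).
Definition tb_b : torus_bundle k := (bvec, 0).
Definition tb_t : torus_bundle k := (0, 1).

Lemma tb_conj_t (x : 'cV[int]_2) :
  (tb_t * ((x, 0) : torus_bundle k) * tb_t^-1)%g = (Tmx k *m x, 0).
Proof.
rewrite -[LHS]/(tb_mul (tb_mul tb_t (x, 0)) (tb_inv tb_t)) /tb_mul /=.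
by rewrite !mulmx0 oppr0 !mulmx0 !addr0 add0r expr1z.
Qed.

Lemma tb_expg_vec (x : 'cV[int]_2) m :
  (((x, 0) : torus_bundle k) ^+ m)%g = (x *+ m, 0).
Proof.
elim: m => [|m IHm] //; rewrite expgS IHm mulrS.
by rewrite -[LHS]/(tb_mul (x, 0) (x *+ m, 0)) /tb_mul /= expr0z mul1mx addr0.
Qed.

Lemma tb_expg_t m : (tb_t ^+ m)%g = (0, m%:Z).
Proof.
elim: m => [|m IHm] //; rewrite expgS IHm.
by rewrite -[LHS]/(tb_mul tb_t (0, m%:Z)) /tb_mul /= mulmx0 addr0 -intS.
Qed.

Let gens : seq (torus_bundle k) := [:: tb_a; tb_b; tb_t].

Lemma tb_word_generated (g : torus_bundle k) : word_generated gens g.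
Proof.
have gen s : s \in gens -> word_generated gens s /\ word_generated gens s^-1%g.
  move=> sS; split; apply: word_generated_letter; rewrite mem_cat ?sS //.
  by rewrite map_f ?orbT.
have genv v m : ((v, 0) : torus_bundle k) \in gens ->
    word_generated gens ((v *~ m, 0) : torus_bundle k).
  move=> /gen[gv gv']; case: m => m.
    by rewrite -tb_expg_vec; apply: word_generatedX.
  have -> : ((v *~ Negz m, 0) : torus_bundle k)
          = (((v, 0) : torus_bundle k)^-1 ^+ m.+1)%g.
    rewrite -[X in (X ^+ _)%g]/(tb_inv (v, 0)) /tb_inv /= oppr0 expr0z mul1mx.
    by rewrite tb_expg_vec NegzE mulrNz mulNrn.
  exact: word_generatedX.
have gent m : word_generated gens ((0, m) : torus_bundle k).
  have /gen[gt gt'] : tb_t \in gens by rewrite !inE eqxx !orbT.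
  case: m => m; first by rewrite -tb_expg_t; apply: word_generatedX.
  have -> : ((0, Negz m) : torus_bundle k) = (tb_t^-1 ^+ m.+1)%g.
    rewrite expVgn tb_expg_t -[RHS]/(tb_inv (0, m.+1%:Z)) /tb_inv /=.
    by rewrite mulmx0 oppr0 NegzE.
  exact: word_generatedX.
case: g => x n.
have -> : ((x, n) : torus_bundle k) =
  (((avec *~ x 0 0, 0) : torus_bundle k) *
   (((bvec *~ x 1%R 0, 0) : torus_bundle k) * ((0, n) : torus_bundle k)))%g.
  rewrite -[RHS]/(tb_mul (_, _) (tb_mul (_, _) (_, _))) /tb_mul /=.
  rewrite !expr0z !mul1mx !add0r addr0; congr (_, _).
  apply/matrixP => i j; rewrite (ord1 j) -!scaler_int !mxE.
  rewrite !andbT !intz; have [->|->] : i = 0 \/ i = 1.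
  - by case: i => [[|[|//]] lti]; [left | right]; apply: val_inj.
  - by rewrite mulr1 mulr0 addr0.
  - by rewrite mulr1 mulr0 add0r.
apply: word_generatedM; first by apply: genv; rewrite !inE eqxx.
by apply: word_generatedM => //; apply: genv; rewrite !inE eqxx orbT.
Qed.

Definition word_length (g : torus_bundle k) : nat :=
  ex_minn (tb_word_generated g).

End WordLength.

(* A Laurent polynomial in Z[X, X^-1], as the finitely supported family of its
   coefficients. *)
Definition laurent : Type := {fsfun int -> int with 0}.

Definition laurent_eval_mx (A : 'M[int]_2) (F : laurent) : 'M[int]_2 :=
  \sum_(j <- finsupp F) F j *: A ^ j.

Definition represents (k : int) (F : laurent) (x : 'cV[int]_2) : Prop :=
  x = laurent_eval_mx (Tmx k) F *m bvec.

Definition polynomial_part (F : laurent) : {poly int} :=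
  \sum_(j <- finsupp F | 0 <= j) F j *: 'X^`|j|%N.

Definition principal_part (F : laurent) : laurent :=
  [fsfun j in finsupp F => if j < 0 then F j else 0].

(* X^-1 Q(X^-1), for Q supported in negative degrees: X^j becomes X^(-j-1). *)
Definition reversal (Q : laurent) : {poly int} :=
  \sum_(j <- finsupp Q) Q j *: 'X^(`|j|.-1).

Lemma sum_finsupp_delta (F : laurent) (i : int) :
  \sum_(j <- finsupp F) (if j == i then F j else 0) = F i.
Proof.
case: (finsuppP F i) => [iF|iF].
  rewrite big_seq big1 // => j jF.
  by case: eqP => // jE; rewrite jE (negPf iF) in jF.
rewrite (bigD1_seq i) ?fset_uniq //= eqxx big1 ?addr0 // => j /negPf -> //.
Qed.

Lemma coef_polynomial_part (F : laurent) (i : nat) :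
  (polynomial_part F)`_i = F i%:Z.
Proof.
rewrite coef_sum.
have coef_term j : (if 0 <= j then (F j *: 'X^`|j|%N : {poly int})`_i else 0)
    = if j == i%:Z then F j else 0.
  have <- : (0 <= j) && (i == `|j|%N) = (j == i%:Z) by lia.
  by rewrite coefZ coefXn mulrC mulr_natl mulrb; case: ifP.
rewrite big_mkcond (eq_bigr _ (fun j _ => coef_term j)).
exact: sum_finsupp_delta.
Qed.

Lemma principal_partE (F : laurent) (j : int) :
  principal_part F j = if j < 0 then F j else 0.
Proof.
rewrite fsfunE; case: finsuppP => //; first by rewrite if_same.
Qed.

Lemma coef_reversal_principal_part (F : laurent) (i : nat) :
  (reversal (principal_part F))`_i = F (- i.+1%:Z).
Proof.
set Q := principal_part F; have -> : F (- i.+1%:Z) = Q (- i.+1%:Z).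
  rewrite /Q principal_partE. by rewrite ltrNl oppr0 ltz_nat.
have coef_term j : (Q j *: 'X^(`|j|%N.-1) : {poly int})`_i
    = if j == - i.+1%:Z then Q j else 0.
  rewrite coefZ coefXn /Q principal_partE.
  case: (ltP j 0) => [j0|j0]; last by rewrite mul0r if_same.
  have -> : (i == `|j|%N.-1) = (j == - i.+1%:Z) by lia.
  by case: eqP => _; rewrite ?mulr1 ?mulr0.
rewrite coef_sum (eq_bigr _ (fun j _ => coef_term j)).
exact: sum_finsupp_delta.
Qed.

(* The endpoints of the range -p-1, ..., q over which F is written. *)
Definition range_p (n : int) (F : laurent) : nat :=
  maxn `|(Num.max 0 (- n))%R|%N (size (reversal (principal_part F))).-1.
Definition range_q (n : int) (F : laurent) : nat :=
  maxn `|(Num.max 0 n)%R|%N (size (polynomial_part F)).-1.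

Lemma size_pred_coefP (P : {poly int}) (M d : nat) :
  ((forall i, P`_i != 0 -> (i <= d)%N) /\ (M <= d)%N
     /\ ((M < d)%N -> P`_d != 0))
  <-> d = maxn M (size P).-1.
Proof.
split=> [[Pd [Md Md0]]|->].
  have szd : ((size P).-1 <= d)%N.
    by have [->|P0] := eqVneq P 0; rewrite ?size_poly0 // Pd // lead_coef_eq0.
  apply/eqP; rewrite eqn_leq geq_max Md szd !andbT leq_max.
  case: (ltnP M d) => [Mltd|_] /=; last by [].
  have Pd0 := Md0 Mltd; have : (d < size P)%N; last by case: (size P).
  by rewrite ltnNge; apply: contra Pd0 => szle; rewrite nth_default.
split; [move=> i Pi | split; [exact: leq_maxl | move=> M_lt]].
- have : (i < size P)%N; last by case: (size P) => // s; rewrite ltnS; lia.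
  by rewrite ltnNge; apply: contra Pi => szle; rewrite nth_default.
- have [szM ->] : (0 < (size P).-1)%N /\ maxn M (size P).-1 = (size P).-1.
    by move: (size P).-1 M_lt => s; lia.
  by rewrite -lead_coefE lead_coef_eq0; apply: contraTneq szM => ->;
    rewrite size_poly0.
Qed.

Lemma range_pP (n : int) (F : laurent) (p : nat) :
  ((forall j, F j != 0 -> - p%:Z - 1 <= j) /\ Num.max 0 (- n) <= p%:Z
     /\ (Num.max 0 (- n) < p%:Z -> F (- p%:Z - 1) != 0))
  <-> p = range_p n F.
Proof.
rewrite /range_p -size_pred_coefP coef_reversal_principal_part.
have -> : - p.+1%:Z = - p%:Z - 1 :> int by lia.
have -> : (`|(Num.max 0 (- n))%R| <= p)%N = (Num.max 0 (- n) <= p%:Z) by lia.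
have -> : (`|(Num.max 0 (- n))%R| < p)%N = (Num.max 0 (- n) < p%:Z) by lia.
split=> -[Fp rest]; split=> //; [move=> i | move=> j Fj].
  by rewrite coef_reversal_principal_part => /Fp; lia.
case: j Fj => i Fi; first by lia.
have : (i <= p)%N by apply: Fp; rewrite coef_reversal_principal_part -NegzE.
by lia.
Qed.

Lemma range_qP (n : int) (F : laurent) (q : nat) :
  ((forall j, F j != 0 -> j <= q%:Z) /\ Num.max 0 n <= q%:Z
     /\ (Num.max 0 n < q%:Z -> F q%:Z != 0))
  <-> q = range_q n F.
Proof.
rewrite /range_q -size_pred_coefP coef_polynomial_part.
have -> : (`|(Num.max 0 n)%R| <= q)%N = (Num.max 0 n <= q%:Z) by lia.
have -> : (`|(Num.max 0 n)%R| < q)%N = (Num.max 0 n < q%:Z) by lia.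
split=> -[Fq rest]; split=> //; [move=> i | move=> j Fj].
  by rewrite coef_polynomial_part => /Fq; lia.
case: j Fj => i Fi; last by lia.
by rewrite lez_nat; apply: Fq; rewrite coef_polynomial_part.
Qed.

Definition n_length (n : int) (F : laurent) : int :=
  let p := range_p n F in
  let q := range_q n F in
  2 * p%:Z + 2 * q%:Z - `|n|
    + \sum_(i < (p + q).+2) `|F (i%:Z - p%:Z - 1)|.

Definition n_minimal_representative (k n : int) (x : 'cV[int]_2) (F : laurent)
    : Prop :=
  represents k F x
  /\ n_length n F = (word_length ((x, n) : torus_bundle k))%:Z.

(* Integer indices, so that c_(-1) and the like are 0. *)
Definition poly_coef (P : {poly int}) (j : int) : int :=
  if 0 <= j then P`_`|j|%N else 0.

Definition signp (x : int) : int := if 0 <= x then 1 else -1.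

(* Meaningful for l <= j. *)
Definition Pot (k : int) (c : int -> int) (j l : int) : int :=
  \sum_(d < `|j - l|%N.+1) ((2 * k - 1) - 2 * `|c (l + d%:Z)|).

(* In the rules below m is the degree and c the family of coefficients.  A
   condition (c_j, ..., c_l) = ±(c'_j, ..., c'_l) is rendered with a sign
   e = ±1 and the family c' = e c.  Rules 4 and 5 need no bound i <= m: entries
   outside [0, m] are 0, which the hypotheses exclude when k >= 2. *)
Section Rules.
Context (k n m : int) (c : int -> int).

Definition rule1 : Prop :=
  n <= m ->
    `|c m| <= k + 2 /\ (Num.sg (c m * c (m - 1)) < 0 -> `|c m| <= k + 1).

Definition rule2 : Prop :=
  forall i : int, 0 <= i -> (i = m /\ m < n) \/ i < m ->
    [/\ `|c i| <= k + 1,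
        (Num.sg (c (i + 1) * c i) < 0 \/ Num.sg (c i * c (i - 1)) < 0 ->
           `|c i| <= k)
      & (Num.sg (c (i + 1) * c i) < 0 /\ Num.sg (c i * c (i - 1)) < 0 ->
           `|c i| <= k - 1)].

Definition rule3 : Prop :=
  n < m -> forall e : int, e \in [:: 1; -1] ->
    (c m, c (m - 1)) <> (e * 1, e * (- k))
    /\ (Num.sg (c (m - 1) * c (m - 2)) < 0 ->
          (c m, c (m - 1)) <> (e * 1, e * (- k + 1))).

Definition rule4 : Prop :=
  n < m -> forall i e : int, 1 <= i -> e \in [:: 1; -1] ->
    let c' := fun s => e * c s in
    c' m = 1 ->
    c' (m - 1) \in [:: - k + 1; - k + 2] ->
    (forall j : int, 1 < j < i -> c' (m - j) \in [:: - k + 1; - k]) ->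
    c' (m - i) \in [:: - k; - k - 1] ->
    (0 < Num.sg (c m * c (m - i - 1)) -> 2 <= Pot k c' (m - 1) (m - i))
    /\ (Num.sg (c m * c (m - i - 1)) <= 0 -> 0 < Pot k c' (m - 1) (m - i)).

Definition rule5 : Prop :=
  n <= m -> forall i e : int, 1 <= i -> e \in [:: 1; -1] ->
    let c' := fun s => e * c s in
    c' m \in [:: k + 1; k + 2] ->
    (forall j : int, 0 < j < i -> c' (m - j) \in [:: k - 1; k]) ->
    c' (m - i) \in [:: k; k + 1] ->
    (0 <= Num.sg (c m * c (m - i - 1)) -> - 6 < Pot k c' m (m - i))
    /\ (Num.sg (c m * c (m - i - 1)) < 0 -> - 4 <= Pot k c' m (m - i)).

Definition rule6 : Prop :=
  forall l j e : int, 0 <= l < j -> 0 < j < m \/ (0 < j /\ j = m /\ m < n) ->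
    e \in [:: 1; -1] ->
    let c' := fun s => e * c s in
    c' j \in [:: k; k + 1] ->
    c' l \in [:: k; k + 1] ->
    (forall s : int, l < s < j -> c' s \in [:: k - 1; k]) ->
    (0 <= Num.sg (c j * c (l - 1)) ->
       - 3 - signp (c j * c (j + 1)) < Pot k c j l)
    /\ (Num.sg (c j * c (l - 1)) < 0 ->
       - 1 - signp (c j * c (j + 1)) <= Pot k c j l).

End Rules.

Definition n_reduced (k n : int) (P : {poly int}) : Prop :=
  P = 0 \/
  let m : int := (size P).-1%:Z in
  let c := poly_coef P in
  [/\ rule1 k n m c, rule2 k n m c & rule3 k n m c] /\
  [/\ rule4 k n m c, rule5 k n m c & rule6 k n m c].

Definition principal_n_reduced (k n : int) (Q : laurent) : Prop :=
  n_reduced k (- n) (reversal Q).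

(* Main.v *)
Require Import Defs.
From mathcomp Require Import all_boot all_order all_algebra.
From mathcomp Require Import finmap zify.
From Stdlib Require Import Classical.

Import Order.TTheory GRing.Theory Num.Theory.
Local Open Scope ring_scope.

(** Let r(X) = X^2 - (2k+1) X + 1 be the characteristic polynomial of T. Since
    r(T) = 0, adding a multiple of r to a representative of x gives another
    representative of x. As a = T^-1 b, a word for (x, t^n) spells a
    representative of x, and a cheapest path through the heights -p, ..., q
    turns a representative F into a word of length L_n(F); hence ||(x, t^n)|| is
    the minimum of L_n over the representatives of x
    ([word_length_le_n_length], [n_minimal_exists]).

    Each of the six rules, when violated at coefficients c_l, ..., c_j of the
    polynomial part, points to a move: subtract 2k-1 from each of these
    coefficients, once more 1 from c_l and from c_j, and add 1 to the two
    neighbours c_(l-1) and c_(j+1), everything up to a common sign. The move is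
    the addition of a multiple of r, and its effect on L_n is the sum Pot of the
    rule, plus 2 for the two ends, plus or minus 1 for each neighbour, plus 2 or
    minus 2 if the degree goes up or down ([move_cost_Pot]). A violated rule says
    that this effect is negative, which contradicts minimality, or, in rules 4, 5
    and 6, that it is zero while |c_(l-1)| increases.

    Moves of the second kind must be shown to terminate. After such a move c_l
    and c_(l-1) have opposite signs, which they had not before; the sign changes
    between consecutive coefficients below c_(l-1) are untouched, and the one
    between c_(l-2) and c_(l-1) cannot disappear because c_(l-1) moves away from
    0. Weight the sign change between c_(i-1) and c_i by 2^(N-|i|): the one that
    appears outweighs all those that may be lost above it. So a minimal
    representative of maximal [potential] admits no such move.

    The substitution X^i -> X^(-1-i) exchanges polynomial and principal parts
    and n with -n. It respects the moves, the length and the potential, so the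
    argument for the polynomial part also covers the principal part. For this
    reason [optimal] refers to an arbitrary class of Laurent polynomials closed
    under the moves and not to the representatives of x. *)

(** * Finitely supported families *)

(** Sums over the support, over a range containing it and over a few indices are
    compared through this one lemma. *)
Lemma eq_big_support (V : nmodType) (I : eqType) (h : I -> V) (s1 s2 : seq I) :
  uniq s1 -> uniq s2 ->
  (forall j, h j != 0 -> (j \in s1) && (j \in s2)) ->
  \sum_(j <- s1) h j = \sum_(j <- s2) h j.
Proof.
move=> u1 u2 hs.
have supp s : \sum_(j <- s) h j = \sum_(j <- [seq j <- s | h j != 0]) h j.
  rewrite (bigID (fun j => h j != 0)) /= [X in _ + X]big1 ?addr0 ?big_filter //.
  by move=> j; rewrite negbK => /eqP.
rewrite (supp s1) (supp s2); apply: perm_big; apply: uniq_perm.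
- exact: filter_uniq.
- exact: filter_uniq.
move=> j; rewrite !mem_filter; case: (boolP (h j != 0)) => //= /hs /andP[].
by move=> -> ->.
Qed.

Definition window (l : int) (d : nat) : seq int :=
  [seq l + i%:Z | i <- iota 0 d].

Lemma window_uniq l d : uniq (window l d).
Proof. by rewrite map_inj_uniq ?iota_uniq // => i j /addrI []. Qed.

Lemma mem_window l d j : (j \in window l d) = (l <= j < l + d%:Z).
Proof.
apply/mapP/idP => [[i] | jl]; first by rewrite mem_iota => i_d ->; lia.
by exists `|j - l|%N; rewrite ?mem_iota; lia.
Qed.

Lemma big_window (V : nmodType) (h : int -> V) l d :
  \sum_(j <- window l d) h j = \sum_(i < d) h (l + i%:Z).
Proof. by rewrite big_map -{1}(subn0 d) -/(index_iota 0 d) big_mkord. Qed.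

Lemma laurent_of_support (f : int -> int) (s : seq int) :
  (forall j, f j != 0 -> j \in s) -> exists F : laurent, F =1 f.
Proof.
move=> fs; exists [fsfun j in [fset j in s]%fset => f j] => j.
rewrite fsfunE !inE; case: ifP => // jNs; apply/esym/eqP.
by apply: contraFT jNs => /fs.
Qed.

Lemma supp_finsupp (F : laurent) j : F j != 0 -> j \in finsupp F.
Proof. by rewrite mem_finsupp. Qed.

Section Evaluation.
Context (A : 'M[int]_2).

Lemma laurent_eval_window (F : laurent) l d :
  (forall j, F j != 0 -> l <= j < l + d%:Z) ->
  laurent_eval_mx A F = \sum_(i < d) F (l + i%:Z) *: A ^ (l + i%:Z).
Proof.
move=> Fld; rewrite -(big_window _ (fun j => F j *: A ^ j)).
apply: eq_big_support; [exact: fset_uniq | exact: window_uniq |] => j Fj.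
have {}Fj : F j != 0 by apply: contraNneq Fj => ->; rewrite scale0r.
by rewrite supp_finsupp // mem_window Fld.
Qed.

Lemma laurent_eval_perturb (F G : laurent) (h : int -> int) (s : seq int) :
  uniq s -> (forall j, h j != 0 -> j \in s) -> (forall j, G j = F j + h j) ->
  laurent_eval_mx A G = laurent_eval_mx A F + \sum_(j <- s) h j *: A ^ j.
Proof.
move=> us hs GE; set S := undup (finsupp F ++ finsupp G ++ s).
have uS : uniq S by exact: undup_uniq.
have on_S f t : uniq t -> {subset t <= S} -> (forall j, f j != 0 -> j \in t) ->
    \sum_(j <- t) f j *: A ^ j = \sum_(j <- S) f j *: A ^ j.
  move=> ut tS ft; apply: eq_big_support => // j fj.
  have jt : j \in t by apply/ft/(contraNneq _ fj) => ->; rewrite scale0r.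
  by rewrite jt tS.
have FS : {subset finsupp F <= S} by move=> j jF; rewrite mem_undup mem_cat jF.
have GS : {subset finsupp G <= S}.
  by move=> j jG; rewrite mem_undup !mem_cat jG orbT.
have sS : {subset s <= S} by move=> j js; rewrite mem_undup !mem_cat js !orbT.
rewrite /laurent_eval_mx (on_S F) ?fset_uniq //; last exact: supp_finsupp.
rewrite (on_S G) ?fset_uniq //; last exact: supp_finsupp.
rewrite (on_S h s) // -big_split.
by apply: eq_bigr => j _; rewrite GE scalerDl.
Qed.

End Evaluation.

(** * The relation satisfied by T *)

Lemma Tmx_charpoly k : Tmx k * Tmx k - (2 * k + 1) *: Tmx k + 1 = 0.
Proof.
apply/matrixP => i j; rewrite !mxE !big_ord_recl big_ord0 !mxE.
have [-> | ->] : i = 0 \/ i = 1.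
- by case: i => [[|[|//]] lti]; [left | right]; apply: val_inj.
- have [-> | ->] : j = 0 \/ j = 1.
  + by case: j => [[|[|//]] lti]; [left | right]; apply: val_inj.
  + by rewrite /=; lia.
  + by rewrite /=; lia.
- have [-> | ->] : j = 0 \/ j = 1.
  + by case: j => [[|[|//]] lti]; [left | right]; apply: val_inj.
  + by rewrite /=; lia.
  + by rewrite /=; nia.
Qed.

Lemma Tmx_expz_rel k (i : int) :
  Tmx k ^ (i - 1) - (2 * k + 1) *: Tmx k ^ i + Tmx k ^ (i + 1) = 0.
Proof.
have U := Tmx_unit k.
have -> : Tmx k ^ i = Tmx k ^ (i - 1) * Tmx k.
  by rewrite -{3}[Tmx k]expr1z -exprzDr // subrK.
have -> : Tmx k ^ (i + 1) = Tmx k ^ (i - 1) * (Tmx k * Tmx k).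
  rewrite -{3 4}[Tmx k]expr1z -!exprzDr //; congr (_ ^ _); lia.
rewrite -(mulr0 (Tmx k ^ (i - 1))) -(Tmx_charpoly k).
by rewrite mulrDr mulrBr mulr1 -scalerAr -addrA [RHS]addrC (addrC (- _)).
Qed.

(** The coefficients of [- \sum_(l <= i <= j) X^(i-1) r(X)]: overlapping shifts
    of r leave 2k-1 inside, 2k at the two ends (2k+1 if l = j) and -1 on either
    side. *)
Definition block (k l j s : int) : int :=
  (if l <= s <= j then 2 * k - 1 else 0) + (s == l)%:Z + (s == j)%:Z
  - (s == l - 1)%:Z - (s == j + 1)%:Z.

Lemma block_eq0 k l j s : l <= j -> ~~ (l - 1 <= s <= j + 1) -> block k l j s = 0.
Proof. by rewrite /block; case: ifP; lia. Qed.

Lemma represents_block1 k x (F G : laurent) (e i : int) :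
  represents k F x -> (forall s, G s = F s - e * block k i i s) ->
  represents k G x.
Proof.
rewrite /represents => -> GE; congr (_ *m _).
rewrite (laurent_eval_perturb _ F G (fun s => - (e * block k i i s))
  (window (i - 1) 3)) //; last 2 first.
- exact: window_uniq.
- by move=> j; rewrite mem_window /block; case: ifP; lia.
rewrite big_window !big_ord_recl big_ord0 /= !addr0.
have -> : i - 1 + 1%N%:Z = i by lia.
have -> : i - 1 + 2%N%:Z = i + 1 by lia.
have -> : block k i i (i - 1) = - 1 by rewrite /block; case: ifP; lia.
have -> : block k i i i = 2 * k + 1 by rewrite /block; case: ifP; lia.
have -> : block k i i (i + 1) = - 1 by rewrite /block; case: ifP; lia.
rewrite -[LHS]addr0 -(scaler0 _ e) -(Tmx_expz_rel k i); congr (_ + _).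
rewrite !scalerDr scalerN scalerA mulrN1 opprK -scaleNr -addrA.
by congr (_ + _).
Qed.

Definition block_closed (k : int) (V : laurent -> Prop) : Prop :=
  forall (F G : laurent) (e i : int),
    V F -> (forall s, G s = F s - e * block k i i s) -> V G.

Lemma block_closed_block k V (F : laurent) (e l j : int) :
  block_closed k V -> V F -> l <= j ->
  exists G : laurent, V G /\ forall s, G s = F s - e * block k l j s.
Proof.
move=> Vcl VF lj; have -> : j = l + `|j - l|%N%:Z by lia.
elim: `|j - l|%N => [|d [G [VG GE]]].
  have [s|G GE] := laurent_of_support (fun s => F s - e * block k l l s)
      (finsupp F ++ window (l - 1) 3).
    rewrite mem_cat mem_window; have [->|/supp_finsupp-> //] := eqVneq (F s) 0.
    by rewrite /block; case: ifP; lia.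
  exists G; split; first exact: Vcl VF GE.
  by move=> s; rewrite GE addr0.
have [s|G' GE'] := laurent_of_support
    (fun s => G s - e * block k (l + d.+1%:Z) (l + d.+1%:Z) s)
    (finsupp G ++ window (l + d%:Z) 3).
  rewrite mem_cat mem_window; have [->|/supp_finsupp-> //] := eqVneq (G s) 0.
  by rewrite /block; case: ifP; lia.
exists G'; split; first exact: Vcl VG GE'.
move=> s; rewrite GE' GE -addrA -opprD -mulrDr; congr (_ - _ * _).
by rewrite /block; do 3!case: ifP; lia.
Qed.

(** * Words and word length *)

Lemma has_word_of_lengthP (G : groupType) (S : seq G) (g : G) (d : nat) :
  has_word_of_length S g d <->
  exists w : seq G,
    [/\ {subset w <= letters S}, size w = d & (\prod_(s <- w) s)%g = g].
Proof.
split=> [/existsP[w /eqP <-] | [w [wS <- <-]]].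
  exists [seq val s | s <- w]; rewrite size_map size_tuple big_map; split=> //.
  by move=> _ /mapP[s _ ->]; exact: valP.
have [v <-] : exists v : seq (seq_sub (letters S)), [seq val s | s <- v] = w.
  elim: w wS => [|s w IHw] wS; first by exists [::].
  have [|v vw] := IHw; first by move=> t tw; rewrite wS // in_cons tw orbT.
  by exists (SeqSub (wS s (mem_head s w)) :: v); rewrite /= vw.
by rewrite size_map big_map; apply/existsP; exists (in_tuple v).
Qed.

Section WordLengthBounds.
Context (k : int).
Implicit Types (g h : torus_bundle k) (v : 'cV[int]_2) (m d : nat).

Let gens : seq (torus_bundle k) := [:: tb_a k; tb_b k; tb_t k].

Lemma tb_mulE v w (m n : int) :
  (((v, m) : torus_bundle k) * ((w, n) : torus_bundle k))%g
    = (v + Tmx k ^ m *m w, m + n).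
Proof. by []. Qed.

Lemma word_length_le g (w : seq (torus_bundle k)) :
  {subset w <= letters gens} -> (\prod_(s <- w) s)%g = g ->
  (word_length g <= size w)%N.
Proof.
move=> wS wg; rewrite /word_length; case: ex_minnP => d _; apply.
by apply/has_word_of_lengthP; exists w.
Qed.

Lemma word_length_word g :
  exists w, [/\ {subset w <= letters gens}, size w = word_length g
              & (\prod_(s <- w) s)%g = g].
Proof.
rewrite /word_length; case: ex_minnP => d gd _.
exact/has_word_of_lengthP.
Qed.

Lemma word_lengthM g h : (word_length (g * h)%g <= word_length g + word_length h)%N.
Proof.
have [u [uS <- ug]] := word_length_word g.
have [v [vS <- vh]] := word_length_word h.
rewrite -size_cat; apply: word_length_le; last by rewrite big_cat ug vh.
by move=> s; rewrite mem_cat => /orP[/uS | /vS].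
Qed.

Lemma letters_inv s : s \in letters gens -> s^-1%g \in letters gens.
Proof.
rewrite !mem_cat => /orP[sS | /mapP[r rS ->]]; last by rewrite invgK rS.
by rewrite map_f ?orbT.
Qed.

Lemma word_lengthV_le g : (word_length g^-1%g <= word_length g)%N.
Proof.
have [w [wS <- <-]] := word_length_word g.
rewrite -(size_map (fun s => s^-1%g)) -size_rev; apply: word_length_le.
  by move=> s; rewrite mem_rev => /mapP[r /wS rS ->]; exact: letters_inv.
elim: w {wS} => [|s w IHw]; first by rewrite !big_nil invg1.
rewrite map_cons rev_cons -cats1 big_cat big_seq1 /= big_cons invgM.
by rewrite -IHw.
Qed.

Lemma word_lengthV g : word_length g^-1%g = word_length g.
Proof. by apply/eqP; rewrite eqn_leq -{3}(invgK g) !word_lengthV_le. Qed.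

Lemma word_length1 : word_length (1%g : torus_bundle k) = 0%N.
Proof.
apply/eqP; rewrite -leqn0; apply: (word_length_le _ [::]) => //.
by rewrite big_nil.
Qed.

Lemma word_length_letter g : g \in gens -> (word_length g <= 1)%N.
Proof.
move=> gS; apply: (word_length_le _ [:: g]); last by rewrite big_seq1.
by move=> s; rewrite inE mem_cat => /eqP ->; rewrite gS.
Qed.

Lemma word_lengthX g m : (word_length (g ^+ m)%g <= word_length g * m)%N.
Proof.
elim: m => [|m IHm]; first by rewrite word_length1.
by rewrite expgS (leq_trans (word_lengthM _ _)) // mulnS leq_add.
Qed.

Lemma word_length_letterX g m : g \in gens -> (word_length (g ^+ m)%g <= m)%N.
Proof.
move=> gS; apply: leq_trans (word_lengthX g m) _.
by rewrite -[leqRHS]mul1n leq_mul // word_length_letter.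
Qed.

Lemma word_length_vec v (c : int) : ((v, 0) : torus_bundle k) \in gens ->
  (word_length ((c *: v, 0%R) : torus_bundle k) <= `|c|)%N.
Proof.
move=> vS; case: c => m.
  have -> : ((Posz m *: v, 0%R) : torus_bundle k) = (((v, 0%R) : torus_bundle k) ^+ m)%g.
    by rewrite tb_expg_vec -[Posz m]natz scaler_nat.
  exact: word_length_letterX.
have -> : ((Negz m *: v, 0%R) : torus_bundle k)
    = (((v, 0%R) : torus_bundle k) ^+ m.+1)^-1%g.
  rewrite tb_expg_vec -[RHS]/(tb_inv (_, _)) /tb_inv /= oppr0 expr0z mul1mx.
  by rewrite NegzE scaleNr -[Posz _]natz scaler_nat.
by rewrite word_lengthV; exact: word_length_letterX.
Qed.

Lemma word_length_t (n : int) :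
  (word_length ((0%R, n) : torus_bundle k) <= `|n|)%N.
Proof.
have tS : tb_t k \in gens by rewrite !inE eqxx !orbT.
case: n => m; first by rewrite -tb_expg_t; exact: word_length_letterX.
have -> : ((0%R, Negz m) : torus_bundle k) = (tb_t k ^+ m.+1)^-1%g.
  by rewrite tb_expg_t -[RHS]/(tb_inv (_, _)) /tb_inv /= mulmx0 oppr0 NegzE.
by rewrite word_lengthV; exact: word_length_letterX.
Qed.

Lemma word_length_a (c : int) :
  (word_length ((c *: avec, 0%R) : torus_bundle k) <= `|c|)%N.
Proof. by apply: word_length_vec; rewrite !inE eqxx. Qed.

Lemma word_length_b (c : int) :
  (word_length ((c *: bvec, 0%R) : torus_bundle k) <= `|c|)%N.
Proof. by apply: word_length_vec; rewrite !inE eqxx orbT. Qed.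

(** Why the coefficient of index -p-1 comes for free at height -p: the letter a
    at height i contributes T^(i-1) b. *)
Lemma Tmx_avec : Tmx k *m avec = bvec.
Proof.
apply/matrixP => i j; rewrite (ord1 j) !mxE !big_ord_recl big_ord0 !mxE /=.
have [-> | ->] : i = 0 \/ i = 1; last 2 first.
- by rewrite /=; lia.
- by rewrite /=; lia.
by case: i => [[|[|//]] lti]; [left | right]; apply: val_inj.
Qed.

Lemma Tmx_expz_avec (i : int) : Tmx k ^ i *m avec = Tmx k ^ (i - 1) *m bvec.
Proof.
rewrite -Tmx_avec mulmxA -[Tmx k ^ _ *m Tmx k]/(_ * _).
by rewrite -{3}[Tmx k]expr1z -(exprzDr (Tmx_unit k)) subrK.
Qed.

Lemma word_lengthM_le g h (c : int) d :
  (word_length g)%:Z <= c -> (word_length h <= d)%N ->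
  (word_length (g * h)%g)%:Z <= c + d%:Z.
Proof. by move=> gc hd; have := word_lengthM g h; lia. Qed.

(** The element written by a word that visits the heights -p, -p+1, ... and
    contributes c_i copies of T^i b for i = -p-1, -p, ...: at the bottom height
    -p the letter a supplies the coefficient of index -p-1, as a = T^-1 b. *)
Definition level_sum (c : int -> int) (p d : nat) : 'cV[int]_2 :=
  \sum_(i < d) c (i%:Z - p%:Z - 1) *: (Tmx k ^ (i%:Z - p%:Z - 1) *m bvec).

Definition level_norm (c : int -> int) (p d : nat) : int :=
  \sum_(i < d) `|c (i%:Z - p%:Z - 1)|.

Lemma level_sumS c p d :
  level_sum c p d.+1
  = level_sum c p d + c (d%:Z - p%:Z - 1) *: (Tmx k ^ (d%:Z - p%:Z - 1) *m bvec).
Proof. exact: big_ord_recr. Qed.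

Lemma level_normS c p d :
  level_norm c p d.+1 = level_norm c p d + `|c (d%:Z - p%:Z - 1)|.
Proof. exact: big_ord_recr. Qed.

Lemma word_length_sweep (c : int -> int) (p d : nat) :
  (word_length ((level_sum c p d.+1, d%:Z - p%:Z) : torus_bundle k))%:Z
   <= p%:Z + d%:Z + level_norm c p d.+1.
Proof.
elim: d => [|d IHd].
  rewrite level_sumS level_normS /level_sum /level_norm !big_ord0 !add0r.
  rewrite -Tmx_expz_avec scalemxAr.
  have -> : ((Tmx k ^ (- p%:Z) *m (c (- p%:Z - 1) *: avec), - p%:Z)
               : torus_bundle k)
      = (((0%R, (- p%:Z)%R) : torus_bundle k)
          * ((c (- p%:Z - 1)%R *: avec, 0%R) : torus_bundle k))%g.
    by rewrite tb_mulE add0r addr0.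
  have descent : (word_length ((0, - p%:Z) : torus_bundle k))%:Z <= p%:Z.
    by rewrite lez_nat; apply: leq_trans (word_length_t _) _; lia.
  apply: le_trans (word_lengthM_le _ _ _ _ descent (word_length_a _)) _.
  by rewrite abszE addr0.
rewrite level_sumS level_normS; move: IHd.
have -> : d.+1%:Z - p%:Z - 1 = d%:Z - p%:Z by lia.
set s := level_sum c p d.+1; set r := level_norm c p d.+1; set cd := c _.
have -> : ((s + cd *: (Tmx k ^ (d%:Z - p%:Z) *m bvec), d.+1%:Z - p%:Z)
             : torus_bundle k)
    = (((s, (d%:Z - p%:Z)%R) : torus_bundle k)
        * ((cd *: bvec, 0%R) : torus_bundle k) * tb_t k)%g.
  by rewrite !tb_mulE mulmx0 !addr0 scalemxAr; congr (_, _); rewrite ?addr0 /=; lia.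
have tS : tb_t k \in gens by rewrite !inE eqxx !orbT.
move=> IHd.
have step := word_lengthM_le _ _ _ _ IHd (word_length_b cd).
apply: le_trans (word_lengthM_le _ _ _ _ step (word_length_letter _ tS)) _.
lia.
Qed.

(** For n >= 0 the cheapest path descends to -p, climbs to q and returns to n. *)
Lemma word_length_ge0_le (c : int -> int) (p q : nat) (n : int) :
  0 <= n <= q%:Z ->
  (word_length ((level_sum c p (p + q).+2, n) : torus_bundle k))%:Z
   <= 2 * p%:Z + 2 * q%:Z - `|n| + level_norm c p (p + q).+2.
Proof.
move=> nq; have := word_length_sweep c p (p + q).
rewrite (level_sumS _ _ (p + q).+1) (level_normS _ _ (p + q).+1).
have -> : (p + q).+1%:Z - p%:Z - 1 = q%:Z by lia.
have -> : (p + q)%:Z - p%:Z = q%:Z by lia.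
set s := level_sum c p (p + q).+1; set r := level_norm c p (p + q).+1.
set cq := c q%:Z.
have -> : ((s + cq *: (Tmx k ^ q%:Z *m bvec), n) : torus_bundle k)
    = (((s, q%:Z) : torus_bundle k) * ((cq *: bvec, 0%R) : torus_bundle k)
        * ((0%R, (n - q%:Z)%R) : torus_bundle k))%g.
  by rewrite !tb_mulE mulmx0 !addr0 scalemxAr; congr (_, _); rewrite ?addr0 /=; lia.
move=> sweep; have step := word_lengthM_le _ _ _ _ sweep (word_length_b cq).
apply: le_trans (word_lengthM_le _ _ _ _ step (word_length_t _)) _.
lia.
Qed.

Lemma word_length_le_length (c : int -> int) (p q : nat) (n : int) :
  - p%:Z <= n <= q%:Z ->
  (word_length ((level_sum c p (p + q).+2, n) : torus_bundle k))%:Z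
   <= 2 * p%:Z + 2 * q%:Z - `|n| + level_norm c p (p + q).+2.
Proof.
move=> npq; have [n0 | n0] := lerP 0 n.
  by apply: word_length_ge0_le; lia.
(* The inverse of (x, t^n) is (- T^-n x, t^-n): its coefficients are the
   opposite of those of x, shifted by n. *)
rewrite -word_lengthV.
have := word_length_ge0_le (fun i => - c (i + n)) `|(p%:Z + n)%R|%N `|(q%:Z - n)%R|%N (- n).
have -> : (`|(p%:Z + n)%R| + `|(q%:Z - n)%R|)%N = (p + q)%N by lia.
have idx (i : nat) : i%:Z - `|(p%:Z + n)%R|%N%:Z - 1 + n = i%:Z - p%:Z - 1 by lia.
have -> : level_norm (fun i => - c (i + n)) `|(p%:Z + n)%R|%N (p + q).+2
        = level_norm c p (p + q).+2.
  by apply: eq_bigr => i _; rewrite idx normrN.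
have -> : (((level_sum c p (p + q).+2, n) : torus_bundle k)^-1)%g
  = (level_sum (fun i => (- c (i + n)%R)%R) `|(p%:Z + n)%R|%N (p + q).+2, - n).
  rewrite -[LHS]/(tb_inv (_, _)) /tb_inv /=; congr (_, _).
  rewrite mulmx_sumr -sumrN; apply: eq_bigr => i _.
  rewrite idx scaleNr -scalemxAr mulmxA.
  rewrite -[Tmx k ^ _ *m Tmx k ^ _]/(_ * _) -(exprzDr (Tmx_unit k)).
  by congr (- (_ *: (_ ^ _ *m _))); lia.
move=> le_inv; apply: le_trans (le_inv _) _; lia.
Qed.

End WordLengthBounds.

(** * Word length as the minimal length of a representative *)

(** The range starts at -p-1 since the letter a at height -p supplies the
    coefficient of that index. *)
Definition supported (F : laurent) (p q : nat) : Prop :=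
  forall j, F j != 0 -> - p%:Z - 1 <= j <= q%:Z.

Lemma level_norm_window (c : int -> int) (p d : nat) :
  level_norm c p d = \sum_(j <- window (- p%:Z - 1) d) `|c j|.
Proof.
rewrite big_window; apply: eq_bigr => i _; congr `|c _|; lia.
Qed.

Lemma level_norm_supported (F : laurent) (p q p' q' : nat) :
  supported F p q -> supported F p' q' ->
  level_norm F p (p + q).+2 = level_norm F p' (p' + q').+2.
Proof.
move=> Fs Fs'; rewrite !level_norm_window.
apply: eq_big_support => [||j]; try exact: window_uniq.
rewrite normr_eq0 => Fj; rewrite !mem_window.
by have := Fs j Fj; have := Fs' j Fj; lia.
Qed.

(** The point is that the right-hand side ignores the ranges, which may differ
    when the degree changes. *)
Lemma level_normB (F G : laurent) (p q q' : nat) (s : seq int) :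
  supported F p q -> supported G p q' -> uniq s ->
  (forall j, G j != F j -> j \in s) ->
  level_norm G p (p + q').+2 - level_norm F p (p + q).+2
  = \sum_(j <- s) (`|G j| - `|F j|).
Proof.
move=> Fs Gs us FG; set r := maxn q q'.
have Fr : supported F p r by move=> j /Fs; rewrite /r; lia.
have Gr : supported G p r by move=> j /Gs; rewrite /r; lia.
rewrite (level_norm_supported F p q p r) // (level_norm_supported G p q' p r) //.
rewrite !level_norm_window -sumrB; apply: eq_big_support => //.
  exact: window_uniq.
move=> j GF; have neq : G j != F j.
  by apply: contraNneq GF => ->; rewrite subrr.
rewrite FG // mem_window andbT.
have [/eqP Fj0 | /Fr] := boolP (F j == 0); last by lia.
by move: neq; rewrite Fj0 => /Gr; lia.
Qed.

(** [range_p] and [range_q] are the least bounds that contain the support and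
    the endpoints 0 and n of the path. *)
Lemma range_spec n (F : laurent) :
  [/\ supported F (range_p n F) (range_q n F),
      - (range_p n F)%:Z <= n <= (range_q n F)%:Z
    & forall p q : nat, supported F p q -> - p%:Z <= n <= q%:Z ->
        (range_p n F <= p)%N /\ (range_q n F <= q)%N].
Proof.
have [Fp [pn ptop]] := (range_pP n F _).2 erefl.
have [Fq [qn qtop]] := (range_qP n F _).2 erefl.
split; [by move=> j Fj; have := Fp j Fj; have := Fq j Fj; lia | lia |].
move=> p q Fs npq; split.
- rewrite leqNgt; apply/negP => p_lt.
  have /ptop/Fs : Num.max 0 (- n) < (range_p n F)%:Z by lia.
  lia.
- rewrite leqNgt; apply/negP => q_lt.
  have /qtop/Fs : Num.max 0 n < (range_q n F)%:Z by lia.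
  lia.
Qed.

Lemma n_lengthE n (F : laurent) :
  n_length n F = 2 * (range_p n F)%:Z + 2 * (range_q n F)%:Z - `|n|
    + level_norm F (range_p n F) (range_p n F + range_q n F).+2.
Proof. by []. Qed.

Lemma n_length_le n (F : laurent) (p q : nat) :
  supported F p q -> - p%:Z <= n <= q%:Z ->
  n_length n F <= 2 * p%:Z + 2 * q%:Z - `|n| + level_norm F p (p + q).+2.
Proof.
move=> Fs npq; have [Fr _ /(_ p q Fs npq)[ple qle]] := range_spec n F.
by rewrite n_lengthE (level_norm_supported F p q _ _ Fs Fr); lia.
Qed.

Lemma represents_level_sum k (F : laurent) (p q : nat) :
  supported F p q ->
  laurent_eval_mx (Tmx k) F *m bvec = level_sum k F p (p + q).+2.
Proof.
move=> Fs; rewrite (laurent_eval_window _ _ (- p%:Z - 1) (p + q).+2); last first.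
  by move=> j /Fs; lia.
rewrite mulmx_suml; apply: eq_bigr => i _; rewrite -scalemxAl.
by have -> : - p%:Z - 1 + i%:Z = i%:Z - p%:Z - 1 by lia.
Qed.

Lemma word_length_le_n_length k (F : laurent) x n :
  represents k F x -> (word_length ((x, n) : torus_bundle k))%:Z <= n_length n F.
Proof.
have [Fs npq _] := range_spec n F.
rewrite /represents (represents_level_sum k F _ _ Fs) n_lengthE => ->.
exact: word_length_le_length.
Qed.

(** The invariant of reading a word of length d letter by letter: F, supported in
    the range swept so far, records the letters a and b, and the travel cost
    2p + 2q - |n| is at most the number of letters t. *)
Definition spelled k (n : int) x (F : laurent) (p q d : nat) : Prop :=
  [/\ supported F p q, - p%:Z <= n <= q%:Z, represents k F x
    & 2 * p%:Z + 2 * q%:Z - `|n| + level_norm F p (p + q).+2 <= d%:Z].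

(** Appending a^e or b^e at height n changes one coefficient, of index n-1 or n,
    which lies in the range already swept. *)
Lemma spelled_letter k (n : int) x (F : laurent) (p q d : nat) (e i : int) :
  `|e| = 1 -> n - 1 <= i <= n -> spelled k n x F p q d ->
  exists F', spelled k n (x + e *: (Tmx k ^ i *m bvec)) F' p q d.+1.
Proof.
move=> e1 ni [Fs npq Fx Fd].
have [j|F' F'E] := laurent_of_support (fun j => F j + (if j == i then e else 0))
    (i :: finsupp F).
  rewrite inE; case: (j =P i) => [_ | _] /=; rewrite ?orbT ?addr0 //; exact: supp_finsupp.
have F's : supported F' p q.
  by move=> j; rewrite F'E; case: (j =P i) => [-> | _]; [lia | rewrite addr0 => /Fs].
exists F'; split=> //.
  rewrite /represents (laurent_eval_perturb _ F F'
    (fun j => if j == i then e else 0) [:: i]) //.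
    by rewrite big_seq1 eqxx mulmxDl -scalemxAl -Fx.
  by move=> j; rewrite inE; case: (j =P i).
have := level_normB F F' p q q [:: i] Fs F's isT.
rewrite big_seq1 F'E eqxx => diff.
have : level_norm F' p (p + q).+2 - level_norm F p (p + q).+2 <= 1.
  rewrite diff; first by lia.
  by move=> j; rewrite F'E inE; case: (j =P i) => // _; rewrite addr0 eqxx.
lia.
Qed.

Lemma spelled_step k (n : int) x (F : laurent) (p q d : nat) (e : int) :
  `|e| = 1 -> spelled k n x F p q d ->
  exists p' q', spelled k (n + e) x F p' q' d.+1.
Proof.
move=> e1 [Fs npq Fx Fd].
exists (maxn p `|(Num.max 0 (- (n + e)))%R|%N), (maxn q `|(Num.max 0 (n + e))%R|%N).
set p' := maxn p _; set q' := maxn q _.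
have Fs' : supported F p' q' by move=> j /Fs; rewrite /p' /q'; lia.
split=> //; first by rewrite /p' /q'; lia.
by rewrite -(level_norm_supported F p q) // /p' /q'; lia.
Qed.

Lemma spelled_word k (w : seq (torus_bundle k)) :
  {subset w <= letters [:: tb_a k; tb_b k; tb_t k]} ->
  exists F p q, spelled k (\prod_(s <- w) s)%g.2 (\prod_(s <- w) s)%g.1 F p q (size w).
Proof.
elim/last_ind: w => [_ | w s IHw ws].
  have [//|F F0] := laurent_of_support (fun=> 0) [::].
  exists F, 0%N, 0%N; rewrite big_nil; split=> //.
  - by move=> j; rewrite F0.
  - rewrite /represents /laurent_eval_mx big1 ?mul0mx // => j _.
    by rewrite F0 scale0r.
  - by rewrite /level_norm big1 // => i _; rewrite F0.
have [|F [p [q]]] := IHw; first by move=> r rw; rewrite ws // mem_rcons inE rw orbT.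
rewrite -cats1 big_cat big_seq1 size_cat addn1 /=.
case: (\prod_(s <- w) s)%g => x n /= Ftr.
have {ws} : s \in letters [:: tb_a k; tb_b k; tb_t k].
  by rewrite ws // mem_rcons mem_head.
have vec v (e i : int) : `|e| = 1 -> n - 1 <= i <= n ->
    Tmx k ^ n *m v = e *: (Tmx k ^ i *m bvec) ->
    exists F p q, spelled k (((x, n) : torus_bundle k) * ((v, 0%R) : torus_bundle k))%g.2
       (((x, n) : torus_bundle k) * ((v, 0%R) : torus_bundle k))%g.1 F p q (size w).+1.
  move=> e1 ni vE; rewrite tb_mulE addr0 vE /=.
  by have [F' ?] := spelled_letter _ _ _ _ _ _ _ _ _ e1 ni Ftr; exists F', p, q.
have trn (e : int) : `|e| = 1 ->
    exists F p q, spelled k (((x, n) : torus_bundle k) * ((0%R, e) : torus_bundle k))%g.2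
       (((x, n) : torus_bundle k) * ((0%R, e) : torus_bundle k))%g.1 F p q (size w).+1.
  move=> e1; rewrite tb_mulE mulmx0 addr0 /=.
  by have [p' [q' ?]] := spelled_step _ _ _ _ _ _ _ _ e1 Ftr; exists F, p', q'.
have invE (v : 'cV[int]_2) : (((v, 0%R) : torus_bundle k)^-1)%g = (- v, 0).
  by rewrite -[LHS]/(tb_inv (_, _)) /tb_inv /= oppr0 expr0z mul1mx.
have tinvE : ((tb_t k)^-1)%g = (0, - 1).
  by rewrite -[LHS]/(tb_inv (_, _)) /tb_inv /= mulmx0 oppr0.
rewrite !inE => /orP[/eqP-> | /orP[/eqP-> | /orP[/eqP-> |]]].
- by apply: (vec _ 1 (n - 1)); rewrite ?Tmx_expz_avec ?scale1r //; lia.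
- by apply: (vec _ 1 n); rewrite ?scale1r //; lia.
- exact: trn.
case/orP=> [/eqP-> | /orP[/eqP-> | /eqP->]].
- rewrite invE; apply: (vec _ (- 1) (n - 1)) => //; first lia.
  by rewrite mulmxN Tmx_expz_avec scaleN1r.
- rewrite invE; apply: (vec _ (- 1) n) => //; first lia.
  by rewrite mulmxN scaleN1r.
- by rewrite tinvE; apply: trn.
Qed.

Lemma n_minimal_exists k n x : exists F, n_minimal_representative k n x F.
Proof.
have [w [wS wlen wx]] := word_length_word k ((x, n) : torus_bundle k).
have [F [p [q [Fs npq Fx Flen]]]] := spelled_word k w wS.
rewrite wx /= in npq Fx Flen; exists F; split=> //.
apply/eqP; rewrite eq_le word_length_le_n_length // andbT -wlen.
exact: le_trans (n_length_le n F p q Fs npq) Flen.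
Qed.

(** * The potential of a representative *)

(** The weights 2^(N-|i|) decrease away from the boundary between the principal
    and the polynomial part, and each exceeds the sum of all farther ones on its
    side. Only signs matter, so the potential is bounded without any bound on the
    coefficients. *)
Definition potential (N : nat) (F : laurent) : nat :=
  \sum_(0 <= i < (2 * N).+1)
     ((F (i%:Z - N%:Z - 1)%R * F (i%:Z - N%:Z)%R < 0)%R * 2 ^ (N - `|(i%:Z - N%:Z)%R|))%N.

Lemma sum_pow2_lt (m d : nat) :
  (\sum_(m <= i < m + d) 2 ^ ((m + d).-1 - i) < 2 ^ d)%N.
Proof.
elim: d m => [|d IHd] m; first by rewrite addn0 big_geq.
rewrite big_ltn; last by lia.
have := IHd m.+1; have -> : (m.+1 + d)%N = (m + d.+1)%N by lia.
have -> : ((m + d.+1).-1 - m)%N = d by lia.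
by rewrite expnS; lia.
Qed.

(** A sign change that appears at l outweighs all those that disappear above l. *)
Lemma potential_lt (N : nat) (F G : laurent) (l : int) :
  0 <= l <= N%:Z ->
  ~~ (F (l - 1) * F l < 0) -> G (l - 1) * G l < 0 ->
  (forall j, j < l -> F (j - 1) * F j < 0 -> G (j - 1) * G j < 0) ->
  (potential N F < potential N G)%N.
Proof.
(* L is the summation index of the boundary l. *)
move=> lN Fl Gl FG; rewrite /potential; set L := `|(l + N%:Z)%R|%N.
have LE : L%:Z - N%:Z = l by rewrite /L; lia.
have split_at (f : nat -> nat) : (\sum_(0 <= i < (2 * N).+1) f i
    = \sum_(0 <= i < L) f i + (f L + \sum_(L.+1 <= i < (2 * N).+1) f i))%N.
  have Llt : (L < (2 * N).+1)%N by rewrite /L; lia.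
  by rewrite (big_cat_nat (n := L)) ?(ltnW Llt) //= (big_ltn Llt).
rewrite !split_at LE (negbTE Fl) Gl mul0n mul1n add0n.
have below : (\sum_(0 <= i < L) ((F (i%:Z - N%:Z - 1)%R * F (i%:Z - N%:Z)%R < 0)%R
                 * 2 ^ (N - `|(i%:Z - N%:Z)%R|))
   <= \sum_(0 <= i < L) ((G (i%:Z - N%:Z - 1)%R * G (i%:Z - N%:Z)%R < 0)%R
                 * 2 ^ (N - `|(i%:Z - N%:Z)%R|)))%N.
  rewrite !big_nat; apply: leq_sum => i iL; rewrite leq_mul2r; apply/orP; right.
  have /FG : i%:Z - N%:Z < l by lia.
  by case: (_ < 0)%R => // ->.
have above : (\sum_(L.+1 <= i < (2 * N).+1)
      ((F (i%:Z - N%:Z - 1)%R * F (i%:Z - N%:Z)%R < 0)%R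
                 * 2 ^ (N - `|(i%:Z - N%:Z)%R|)) < 2 ^ (N - `|l|))%N.
  apply: leq_ltn_trans (sum_pow2_lt L.+1 (N - `|l|)).
  have -> : (L.+1 + (N - `|l|) = (2 * N).+1)%N by rewrite /L; lia.
  rewrite !big_nat; apply: leq_sum => i iL.
  have -> : (N - `|(i%:Z - N%:Z)%R| = (2 * N).+1.-1 - i)%N by lia.
  by rewrite -[leqRHS]mul1n leq_mul2r leq_b1 orbT.
lia.
Qed.

Lemma potential_le (N : nat) (F : laurent) :
  (potential N F <= (2 * N).+1 * 2 ^ N)%N.
Proof.
rewrite /potential -[X in (_ <= X * _)%N]subn0 -sum_nat_const_nat.
apply: leq_sum => i _; rewrite -[leqRHS]mul1n leq_mul ?leq_b1 //.
by rewrite leq_exp2l // leq_subr.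
Qed.

(** * Reflection *)

Lemma reflection_exists (F : laurent) : exists G : laurent, forall j, G j = F (- 1 - j).
Proof.
apply: (laurent_of_support (fun j => F (- 1 - j)) [seq - 1 - j | j <- finsupp F]).
move=> j /supp_finsupp jF; apply/mapP; exists (- 1 - j) => //; lia.
Qed.

Section Reflection.
Context (F G : laurent) (GE : forall j : int, G j = F (- 1 - j)).

Lemma potential_reflection N : potential N G = potential N F.
Proof.
rewrite /potential [RHS]big_nat_rev /= big_nat [RHS]big_nat.
apply: eq_bigr => i iN; rewrite !GE mulrC.
have -> : - 1 - (i%:Z - N%:Z) = (0 + (2 * N).+1 - i.+1)%N%:Z - N%:Z - 1 by lia.
have -> : - 1 - (i%:Z - N%:Z - 1) = (0 + (2 * N).+1 - i.+1)%N%:Z - N%:Z by lia.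
by congr (_ * 2 ^ (_ - _))%N; lia.
Qed.

Lemma supported_reflection p q : supported F p q -> supported G q p.
Proof. by move=> Fs j; rewrite GE => /Fs; lia. Qed.

Lemma level_norm_reflection (p q : nat) :
  level_norm G q (q + p).+2 = level_norm F p (p + q).+2.
Proof.
rewrite addnC /level_norm (reindex_inj rev_ord_inj); apply: eq_bigr => i _ /=.
by rewrite GE; congr `|F _|; case: i => i /= lti; lia.
Qed.

Lemma n_length_reflection_le (n : int) : n_length (- n) G <= n_length n F.
Proof.
have [Fs npq _] := range_spec n F.
have := n_length_le (- n) G _ _ (supported_reflection _ _ Fs) ltac:(lia).
by rewrite level_norm_reflection (n_lengthE n F); lia.
Qed.

Lemma polynomial_part_reflection :
  polynomial_part G = reversal (principal_part F).
Proof.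
apply/polyP => i; rewrite coef_polynomial_part coef_reversal_principal_part GE.
by congr (F _); lia.
Qed.

End Reflection.

(** * Optimal representatives *)

(** The class V stands for the representatives of x; it is arbitrary so that its
    image under the reflection can be treated too. *)
Definition optimal (n : int) (V : laurent -> Prop) (N : nat) (F : laurent) : Prop :=
  [/\ V F, (range_p n F <= N)%N /\ (range_q n F <= N)%N,
      forall G, V G -> n_length n F <= n_length n G
    & forall G, V G -> n_length n G <= n_length n F ->
        (potential N G <= potential N F)%N].

(** Starting from any minimal representative, increase the potential as long as
    possible: it is bounded. *)
Lemma optimal_exists k (n : int) x :
  exists N F, optimal n (fun F => represents k F x) N F
    /\ n_length n F = (word_length ((x, n) : torus_bundle k))%:Z.
Proof.
set W := word_length _; pose N := (W + `|n|)%N; exists N.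
have inN G : n_length n G = W%:Z -> (range_p n G <= N)%N /\ (range_q n G <= N)%N.
  rewrite n_lengthE.
  have : 0 <= level_norm G (range_p n G) (range_p n G + range_q n G).+2.
    by apply: sumr_ge0 => i _.
  by rewrite /N; lia.
have [F0 [F0x F0len]] := n_minimal_exists k n x; pose M := ((2 * N).+1 * 2 ^ N)%N.
have [d] : exists d, (M - potential N F0 <= d)%N by exists (M - potential N F0)%N.
elim: d F0 F0x F0len => [|d IHd] F Fx Flen Fd.
  exists F; split=> //; split=> // [|G|G _ _]; first exact: inN.
    by rewrite Flen; exact: word_length_le_n_length.
  by have := potential_le N G; rewrite -/M; lia.
have [[G [Gx Glen Gpot]] | noG] := classic (exists G, [/\ represents k G x,
    n_length n G <= n_length n F & (potential N F < potential N G)%N]).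
  apply: (IHd G Gx); last by have := potential_le N G; rewrite -/M; lia.
  by have := word_length_le_n_length k G x n Gx; rewrite -/W; lia.
exists F; split=> //; split=> // [|G|G Gx Glen]; first exact: inN.
  by rewrite Flen; exact: word_length_le_n_length.
by rewrite leqNgt; apply/negP => Gpot; apply: noG; exists G.
Qed.

Lemma optimal_reflection (n : int) V N (F G : laurent) :
  (forall j : int, G j = F (- 1 - j)) -> optimal n V N F ->
  optimal (- n) (fun H : laurent => forall H' : laurent, (forall j : int, H' j = H (- 1 - j)) -> V H') N G.
Proof.
move=> GE [VF FN Fmin Fpot].
have FE j : F j = G (- 1 - j) by rewrite GE; congr (F _); lia.
have [Fs npq _] := range_spec n F; have [_ _ Grange] := range_spec (- n) G.
have [GN1 GN2] := Grange _ _ (supported_reflection F G GE _ _ Fs) ltac:(lia).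
have lenG := n_length_reflection_le F G GE n.
split.
- move=> H' H'E; suff -> : H' = F by [].
  by apply/fsfunP => j; rewrite H'E -FE.
- by lia.
- move=> H VH; have [H' H'E] := reflection_exists H.
  have := n_length_reflection_le _ _ H'E (- n); rewrite opprK.
  by have := Fmin H' (VH H' H'E); lia.
- move=> H VH; have [H' H'E] := reflection_exists H.
  have lenH := n_length_reflection_le _ _ H'E (- n).
  have := n_length_reflection_le _ _ FE (- n).
  rewrite opprK in lenH *; move=> lenF leHG.
  rewrite -(potential_reflection _ _ H'E) (potential_reflection _ _ GE).
  by apply: Fpot; [exact: VH | lia].
Qed.

Lemma block_closed_represents k x : block_closed k (fun F => represents k F x).
Proof. by move=> F G e i; exact: represents_block1. Qed.

Lemma block_closed_reflection k V : block_closed k V ->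
  block_closed k (fun H : laurent => forall H' : laurent, (forall j : int, H' j = H (- 1 - j)) -> V H').
Proof.
move=> Vcl F G e i VF GE G' G'E; have [F' F'E] := reflection_exists F.
apply: (Vcl F' G' e (- 1 - i)); first exact: VF.
move=> s; rewrite G'E GE F'E; congr (_ - _ * _).
by rewrite /block; do 2!case: ifP; lia.
Qed.

(** * The effect of a move on the length *)

Definition move_cost (k e l j : int) (F : int -> int) : int :=
  \sum_(s <- window (l - 1) `|j - l|.+3) (`|F s - e * block k l j s| - `|F s|).

Lemma Pot_window k (c : int -> int) (l j : int) : l <= j ->
  Pot k c j l = \sum_(s <- window l `|j - l|.+1) ((2 * k - 1) - 2 * `|c s|).
Proof. by move=> lj; rewrite big_window. Qed.

Lemma eq_Pot k (c d : int -> int) (l j : int) : l <= j ->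
  (forall s, l <= s <= j -> `|c s| = `|d s|) -> Pot k c j l = Pot k d j l.
Proof.
by move=> lj cd; apply: eq_bigr => -[i /= lti] _; rewrite cd //; lia.
Qed.

Lemma move_cost_ends (k e l j : int) (F : int -> int) : l <= j ->
  move_cost k e l j F
  = (`|F (l - 1) + e| - `|F (l - 1)|) + (`|F (j + 1) + e| - `|F (j + 1)|)
    + \sum_(s <- window l `|j - l|.+1) (`|F s - e * block k l j s| - `|F s|).
Proof.
move=> lj; rewrite /move_cost !big_window big_ord_recl big_ord_recr /=.
have -> : l - 1 + 0 = l - 1 by rewrite addr0.
have -> : l - 1 + `|(j - l)%R|.+2%:Z = j + 1 by lia.
have -> : block k l j (l - 1) = - 1 by rewrite /block; case: ifP; lia.
have -> : block k l j (j + 1) = - 1 by rewrite /block; case: ifP; lia.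
rewrite mulrN1 opprK -[RHS]addrA; congr (_ + _); rewrite [LHS]addrC; congr (_ + _).
apply: eq_bigr => i _ /=.
by have -> : l - 1 + (bump 0 i)%:Z = l + i%:Z by rewrite /bump; lia.
Qed.

Lemma move_cost1 (k e l : int) (F : int -> int) :
  move_cost k e l l F
  = (`|F (l - 1) + e| - `|F (l - 1)|) + (`|F (l + 1) + e| - `|F (l + 1)|)
    + (`|F l - e * (2 * k + 1)| - `|F l|).
Proof.
rewrite move_cost_ends // subrr big_window big_ord_recl big_ord0 /= !addr0.
by have -> : block k l l l = 2 * k + 1 by rewrite /block; case: ifP; lia.
Qed.

(** Inside the block |c| becomes 2k-1-|c|, which accounts for the summands of
    Pot; at the two ends it becomes 2k-|c|, whence the 2. The top coefficient may
    be as large as 2k: rule 5 needs k+2, which is 2k when k = 2. *)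
Lemma move_cost_Pot (k e l j : int) (F : int -> int) : 2 <= k ->
  e \in [:: 1; - 1] -> l < j ->
  (forall s, l <= s <= j -> 0 <= e * F s <= 2 * k - 1 + (s == j)%:Z) ->
  move_cost k e l j F
  = (`|F (l - 1) + e| - `|F (l - 1)|) + (`|F (j + 1) + e| - `|F (j + 1)|)
    + Pot k F j l + 2.
Proof.
move=> k2 es lj Flj; rewrite move_cost_ends ?(ltW lj) // -[RHS]addrA; congr (_ + _).
rewrite Pot_window ?(ltW lj) //.
pose ends (s : int) := (s == l)%:Z + (s == j)%:Z.
have ends2 : \sum_(s <- window l `|j - l|.+1) ends s = 2.
  rewrite (eq_big_support _ _ _ _ [:: l; j]) ?window_uniq //=.
  - by rewrite big_cons big_seq1 /ends; lia.
  - by rewrite inE andbT; lia.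
  - by move=> s; rewrite mem_window !inE /ends; lia.
transitivity (\sum_(s <- window l `|j - l|.+1) ((2 * k - 1) - 2 * `|F s| + ends s)).
  rewrite big_seq [RHS]big_seq; apply: eq_bigr => s.
  rewrite mem_window => sl; have {}sl : l <= s <= j by lia.
  have := Flj s sl; rewrite /block sl /ends.
  have -> : (s == l - 1) = false by lia.
  have -> : (s == j + 1) = false by lia.
  by move: es; rewrite !inE => /orP[] /eqP ->; lia.
by rewrite big_split /= ends2.
Qed.

(** * Optimal representatives have reduced polynomial parts *)

Lemma mulz_lt0 (x y : int) :
  (x * y < 0) = (x < 0) && (0 < y) || (0 < x) && (y < 0).
Proof.
case: (ltrgtP x 0) => [x0|x0|->]; last by rewrite mul0r ltxx.
- by rewrite nmulr_rlt0 ?orbF.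
- by rewrite pmulr_rlt0.
Qed.

Lemma mulz_gt0 (x y : int) :
  (0 < x * y) = (x < 0) && (y < 0) || (0 < x) && (0 < y).
Proof.
case: (ltrgtP x 0) => [x0|x0|->]; last by rewrite mul0r ltxx.
- by rewrite nmulr_rgt0 ?orbF.
- by rewrite pmulr_rgt0.
Qed.

Section OptimalReduced.
Context (k n : int) (k2 : 2 <= k) (V : laurent -> Prop) (Vcl : block_closed k V).
Context (N : nat) (F : laurent) (Fopt : optimal n V N F).

Let q : int := (range_q n F)%:Z.

(** Minimality makes the cost of a move nonnegative. If moreover c_(l-1) moves
    away from 0 and c_l changes sign, then the move creates a sign change at l,
    and maximality of the potential makes the cost positive. *)
Lemma optimal_move (e l j q' : int) :
  0 <= l <= j -> 0 <= q' -> n <= q' ->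
  (forall s, q' < s -> F s = e * block k l j s) ->
  0 <= 2 * (q' - q) + move_cost k e l j F
  /\ (e \in [:: 1; - 1] -> 0 < e * F l < 2 * k -> 0 <= e * F (l - 1) ->
      0 < 2 * (q' - q) + move_cost k e l j F).
Proof.
move=> lj q'0 nq' Fq'; have [VF [pN qN] Fmin Fpot] := Fopt.
have ljle : l <= j by lia.
have [G [VG GE]] := block_closed_block k V F e l j Vcl VF ljle.
have [Fs npq _] := range_spec n F; set p := range_p n F in pN Fs npq.
have Gs : supported G p `|q'|%N.
  move=> s; have [sq' | sq'] := lerP s q'; last first.
    by rewrite GE Fq' ?subrr.
  have [sl | sl] := ltrP s (l - 1); last by lia.
  by rewrite GE block_eq0 ?mulr0 ?subr0 => // [/Fs|]; lia.
have Glen : n_length n G <= n_length n F + (2 * (q' - q) + move_cost k e l j F).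
  have GF : forall s, G s != F s -> s \in window (l - 1) `|j - l|.+3.
    move=> s; rewrite GE mem_window; apply: contraR => sNlj.
    by rewrite block_eq0 ?mulr0 ?subr0; lia.
  have := level_normB F G p _ _ _ Fs Gs (window_uniq _ _) GF.
  under eq_bigr => s _ do rewrite GE.
  rewrite -/(move_cost k e l j F) => <-.
  have := n_length_le n G p _ Gs ltac:(lia).
  by rewrite (n_lengthE n F) -/p /q; lia.
split; first by have := Fmin G VG; lia.
move=> es Fl Fl1; rewrite ltNge; apply/negP => cost0.
have : (potential N G <= potential N F)%N by apply: Fpot => //; lia.
rewrite leqNgt => /negP; apply; apply: (potential_lt N F G l).
(* The index l carries a nonzero coefficient, hence lies within the range. *)
- have : F l != 0 by apply: contraTneq Fl => ->; rewrite mulr0 ltxx.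
  by move/Fs; lia.
- by move: es Fl Fl1; rewrite !inE => /orP[] /eqP ->; nia.
- have Gl1 : G (l - 1) = F (l - 1) + e.
    rewrite GE; have -> : block k l j (l - 1) = - 1; last by rewrite mulrN1 opprK.
    by rewrite /block; case: ifP; lia.
  have [b bE b2k] : exists2 b, G l = F l - e * b & 2 * k <= b.
    by exists (block k l j l); rewrite ?GE // /block; case: ifP; lia.
  by rewrite Gl1 bE; move: es Fl Fl1; rewrite !inE => /orP[] /eqP ->; nia.
- move=> s sl; have Gs1 : G (s - 1) = F (s - 1).
    by rewrite GE block_eq0 ?mulr0 ?subr0; lia.
  rewrite Gs1 GE; have [sl1 | sl1] := ltrP s (l - 1).
    by rewrite block_eq0 ?mulr0 ?subr0; lia.
  have {sl sl1}-> : s = l - 1 by lia.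
  have -> : block k l j (l - 1) = - 1 by rewrite /block; case: ifP; lia.
  by rewrite mulrN1 opprK; move: es Fl1; rewrite !inE => /orP[] /eqP ->; nia.
Qed.

Lemma optimal_single (e l q' : int) :
  0 <= l -> 0 <= q' -> n <= q' ->
  (forall s, q' < s -> F s = e * block k l l s) ->
  0 <= 2 * (q' - q) + (`|F (l - 1) + e| - `|F (l - 1)|)
       + (`|F (l + 1) + e| - `|F (l + 1)|)
       + (`|F l - e * (2 * k + 1)| - `|F l|).
Proof.
move=> l0 q'0 nq' Fq'; have [||||] := optimal_move e l l q' => //; first by lia.
by rewrite move_cost1; lia.
Qed.

(** With d = the cost of the move without the contribution of c_(l-1), this
    combines the two alternatives for c_(l-1): if it moves away from 0 then
    d + 1 > 0 by maximality of the potential, and if it moves towards 0 then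
    d - 1 >= 0 by minimality. When l = 0 the coefficient c_(-1) belongs to the
    principal part and is invisible to the rules, but d + 1 > 0 in either case. *)
Lemma optimal_run (e l j q' : int) :
  e \in [:: 1; - 1] -> 0 <= l < j -> 0 <= q' -> n <= q' ->
  (forall s, q' < s -> F s = e * block k l j s) ->
  (forall s, l <= s <= j -> 0 <= e * F s <= 2 * k - 1 + (s == j)%:Z) -> 0 < e * F l ->
  let d := 2 * (q' - q) + (`|F (j + 1) + e| - `|F (j + 1)|) + Pot k F j l + 2 in
  0 < d + 1 /\ (e * F (l - 1) < 0 -> 0 < d).
Proof.
move=> es lj q'0 nq' Fq' Flj Fl.
have [||||cost_ge0 cost_gt0] := optimal_move e l j q' => //; first by lia.
have Fl2 : 0 < e * F l < 2 * k by have := Flj l; lia.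
move: cost_ge0 (cost_gt0 es Fl2); rewrite move_cost_Pot //; last by lia.
by move: es; rewrite !inE => /orP[] /eqP ->; lia.
Qed.

Let P := polynomial_part F.
Let m : int := (size P).-1%:Z.
Let c : int -> int := poly_coef P.

Lemma poly_coefE s : c s = if 0 <= s then F s else 0.
Proof.
rewrite /c /poly_coef; case: ifP => // s0; rewrite coef_polynomial_part.
by congr (F _); lia.
Qed.

Lemma poly_coef_cases s : (0 <= s /\ c s = F s) \/ (s < 0 /\ c s = 0).
Proof. by rewrite poly_coefE; case: (lerP 0 s) => s0; [left | right]. Qed.

Hypothesis P0 : P != 0.

Lemma degree_facts : [/\ F m != 0, forall s : int, m < s -> F s = 0
  & q = Num.max n m].
Proof.
have mE : F m = lead_coef P by rewrite lead_coefE coef_polynomial_part.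
split; first by rewrite mE lead_coef_eq0.
  move=> s ms; have -> : s = `|s|%N%:Z by lia.
  rewrite -coef_polynomial_part nth_default // -/P; move: ms; rewrite /m. by move: (size P); lia.
by rewrite /q /range_q -/P /m; lia.
Qed.

(** The move raises the degree, which costs 2 for the range and 1 for the new
    leading coefficient. *)
Lemma rule1_optimal : rule1 k n m c.
Proof.
move=> nm; have [Fm Ftop qE] := degree_facts.
have H e : 0 <= 2 + (`|F (m - 1) + e| - `|F (m - 1)|) + `|e|
                  + (`|F m - e * (2 * k + 1)| - `|F m|).
  have Fq s : m + 1 < s -> F s = e * block k m m s.
    by move=> ms; rewrite Ftop ?block_eq0 ?mulr0; lia.
  have := optimal_single e m (m + 1) ltac:(lia) ltac:(lia) ltac:(lia) Fq.
  by rewrite (Ftop (m + 1)); lia.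
have := H 1; have := H (- 1); rewrite sgr_lt0 mulz_lt0.
have := poly_coef_cases m; have := poly_coef_cases (m - 1).
lia.
Qed.

Lemma rule2_optimal : rule2 k n m c.
Proof.
move=> i i0 im; have [Fm Ftop qE] := degree_facts.
have H e : 0 <= (`|F (i - 1) + e| - `|F (i - 1)|)
    + (`|F (i + 1) + e| - `|F (i + 1)|) + (`|F i - e * (2 * k + 1)| - `|F i|).
  have Fq s : q < s -> F s = e * block k i i s.
    by move=> qs; rewrite Ftop ?block_eq0 ?mulr0; lia.
  have := optimal_single e i q ltac:(lia) ltac:(lia) ltac:(lia) Fq.
  by lia.
have := H 1; have := H (- 1); rewrite !sgr_lt0 !mulz_lt0.
have := poly_coef_cases (i - 1); have := poly_coef_cases i.
have := poly_coef_cases (i + 1).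
by split; lia.
Qed.

(** The move, with sign opposite to that of c_m, cancels the leading coefficient
    and lowers the degree. *)
Lemma rule3_optimal : rule3 k n m c.
Proof.
move=> nm e es; have [Fm Ftop qE] := degree_facts.
have H : F m = e -> 0 < m -> 0 <= - 2 + (`|F (m - 2) - e| - `|F (m - 2)|)
    - 1 + (`|F (m - 1) + e * (2 * k + 1)| - `|F (m - 1)|).
  move=> Fe m0.
  have Fq s : m - 1 < s -> F s = - e * block k (m - 1) (m - 1) s.
    move=> sm; have [-> | neq] := eqVneq s m; last first.
      by rewrite Ftop ?block_eq0 ?mulr0; lia.
    have -> : block k (m - 1) (m - 1) m = - 1 by rewrite /block; case: ifP; lia.
    by rewrite mulrNN mulr1.
  have := optimal_single (- e) (m - 1) (m - 1) ltac:(lia) ltac:(lia) ltac:(lia) Fq.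
  have -> : m - 1 - 1 = m - 2 by lia.
  have -> : m - 1 + 1 = m by lia.
  by move: es; rewrite !inE => /orP[] /eqP ?; lia.
move: H; rewrite sgr_lt0 mulz_lt0.
have := poly_coef_cases m; have := poly_coef_cases (m - 1).
have := poly_coef_cases (m - 2).
by move: es; rewrite !inE => /orP[] /eqP -> *; split=> [|?] []; lia.
Qed.

(** The move on c_(m-1), ..., c_(m-i) cancels the leading coefficient and lowers
    the degree: in [optimal_run], d = Pot - 1. *)
Lemma rule4_optimal : rule4 k n m c.
Proof.
move=> nm i e i1 es; cbv zeta; have [Fm Ftop qE] := degree_facts.
have [l lE] : exists l : int, l = m - i by exists (m - i).
rewrite -lE => cm cm1 cmid cl.
have cE (s : int) : 0 <= s -> c s = F s by rewrite poly_coefE => ->.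
have l0 : 0 <= l.
  by have [[] // | [_ cl0]] := poly_coef_cases l; move: cl; rewrite cl0 mulr0 !inE; lia.
have lm : l < m - 1.
  (* For i = 1 the constraints on the two ends of the run are incompatible. *)
  have [i1E | ] := eqVneq i 1; last by lia.
  by move: cm1 cl; rewrite lE i1E !inE; move: (c (m - 1)) => y; lia.
have run (s : int) : l <= s <= m - 1 -> 0 <= - e * F s <= 2 * k - 1 + (s == m - 1)%:Z.
  move=> sl; rewrite mulNr -cE; last by lia.
  have [-> | s1] := eqVneq s (m - 1); first by move: cm1; rewrite !inE; move: (c (m - 1)) => y; lia.
  have [-> | s2] := eqVneq s l; first by move: cl; rewrite !inE; move: (c l) => y; lia.
  have := cmid (m - s) ltac:(lia); have -> : m - (m - s) = s by lia.
  by rewrite !inE; move: (c s) => y; lia.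
have Fq (s : int) : m - 1 < s -> F s = - e * block k l (m - 1) s.
  move=> sm; have [-> | neq] := eqVneq s m; last first.
    by rewrite Ftop ?block_eq0 ?mulr0; lia.
  have -> : block k l (m - 1) m = - 1 by rewrite /block; case: ifP; lia.
  by move: cm; rewrite cE; last lia; move: (F m) => y; move: es; rewrite !inE => /orP[] /eqP ->; lia.
have Nes : - e \in [:: 1; - 1] by move: es; rewrite !inE; lia.
have Fl : 0 < - e * F l by rewrite mulNr -cE //; move: cl; rewrite !inE; move: (c l) => y; lia.
have Pot_gt := optimal_run (- e) l (m - 1) (m - 1) Nes ltac:(lia) ltac:(lia)
  ltac:(lia) Fq run Fl.
rewrite sgr_gt0 sgr_le0 leNgt mulz_gt0.
rewrite (eq_Pot k _ F) ?(ltW lm) //; last first.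
  move=> s sl; rewrite cE; last by lia.
  by move: (F s) es => y; rewrite !inE => /orP[] /eqP ->; lia.
move: Pot_gt cm; have -> : m - 1 + 1 = m by lia.
rewrite cE; last by lia.
move: (Pot k F (m - 1) l) => pot.
have := poly_coef_cases (l - 1); move: (F (l - 1)) (c (l - 1)) (F m) => y z w.
by move: es; rewrite !inE => /orP[] /eqP ->; lia.
Qed.

(** The move raises the degree: in [optimal_run], d = Pot + 5. *)
Lemma rule5_optimal : rule5 k n m c.
Proof.
move=> nm i e i1 es; cbv zeta; have [Fm Ftop qE] := degree_facts.
have [l lE] : exists l : int, l = m - i by exists (m - i).
rewrite -lE => cm cmid cl.
have cE (s : int) : 0 <= s -> c s = F s by rewrite poly_coefE => ->.
have l0 : 0 <= l.
  by have [[] // | [_ cl0]] := poly_coef_cases l; move: cl; rewrite cl0 mulr0 !inE; lia.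
have run (s : int) : l <= s <= m -> 0 <= e * F s <= 2 * k - 1 + (s == m)%:Z.
  move=> sl; rewrite -cE; last by lia.
  have [-> | s1] := eqVneq s m; first by move: cm; rewrite !inE; move: (c m) => y; lia.
  have [-> | s2] := eqVneq s l; first by move: cl; rewrite !inE; move: (c l) => y; lia.
  have := cmid (m - s) ltac:(lia); have -> : m - (m - s) = s by lia.
  by rewrite !inE; move: (c s) => y; lia.
have Fq (s : int) : m + 1 < s -> F s = e * block k l m s.
  by move=> ms; rewrite Ftop ?block_eq0 ?mulr0; lia.
have Fl : 0 < e * F l by rewrite -cE //; move: cl; rewrite !inE; move: (c l) => y; lia.
have lm : l < m by lia.
have Pot_gt := optimal_run e l m (m + 1) es ltac:(lia) ltac:(lia) ltac:(lia) Fq run Fl.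
rewrite sgr_ge0 sgr_lt0 leNgt mulz_lt0.
rewrite (eq_Pot k _ F) ?(ltW lm) //; last first.
  move=> s sl; rewrite cE; last by lia.
  by move: (F s) es => y; rewrite !inE => /orP[] /eqP ->; lia.
move: Pot_gt cm; rewrite (cE m) // (Ftop (m + 1)); last by lia.
move: (Pot k F m l) => pot; have := poly_coef_cases (l - 1).
move: (F (l - 1)) (c (l - 1)) (F m) => x y z.
by move: es; rewrite !inE => /orP[] /eqP ->; lia.
Qed.

(** The degree does not exceed the range, and c_(j+1) contributes exactly the
    [signp] of the rule. *)
Lemma rule6_optimal : rule6 k n m c.
Proof.
move=> l j e lj jm es; cbv zeta => cj cl cmid; have [Fm Ftop qE] := degree_facts.
have cE (s : int) : 0 <= s -> c s = F s by rewrite poly_coefE => ->.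
have run (s : int) : l <= s <= j -> 0 <= e * F s <= 2 * k - 1 + (s == j)%:Z.
  move=> sl; rewrite -cE; last by lia.
  have [-> | s1] := eqVneq s j; first by move: cj; rewrite !inE; move: (c j) => y; lia.
  have [-> | s2] := eqVneq s l; first by move: cl; rewrite !inE; move: (c l) => y; lia.
  have := cmid s ltac:(lia).
  by rewrite !inE; move: (c s) => y; lia.
have Fq (s : int) : q < s -> F s = e * block k l j s.
  by move=> qs; rewrite Ftop ?block_eq0 ?mulr0; lia.
have Fl : 0 < e * F l.
  by rewrite -cE; last lia; move: cl; rewrite !inE; move: (c l) => y; lia.
have Pot_gt := optimal_run e l j q es ltac:(lia) ltac:(lia) ltac:(lia) Fq run Fl.
rewrite sgr_ge0 sgr_lt0 leNgt mulz_lt0 /signp [0 <= _ * _]leNgt mulz_lt0.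
rewrite (eq_Pot k c F); [|lia|]; last first.
  by move=> s sl; rewrite cE; last by lia.
move: Pot_gt cj; rewrite (cE j); last by lia.
rewrite (cE (j + 1)); last by lia.
move: (Pot k F j l) => pot; have := poly_coef_cases (l - 1).
move: (F (l - 1)) (c (l - 1)) (F j) (F (j + 1)) => x y z w.
by move: es; rewrite !inE => /orP[] /eqP ->; case: ifP; lia.
Qed.

End OptimalReduced.

Lemma optimal_n_reduced (k n : int) (V : laurent -> Prop) (N : nat) (F : laurent) :
  2 <= k -> block_closed k V -> optimal n V N F ->
  n_reduced k n (polynomial_part F).
Proof.
move=> k2 Vcl Fopt; have [-> | P0] := eqVneq (polynomial_part F) 0; first by left.
by right; split; split; [
  exact: rule1_optimal Vcl N F Fopt P0 |
  exact: rule2_optimal Vcl N F Fopt P0 |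
  exact: rule3_optimal Vcl N F Fopt P0 |
  exact: rule4_optimal k2 V Vcl N F Fopt P0 |
  exact: rule5_optimal k2 V Vcl N F Fopt P0 |
  exact: rule6_optimal k2 V Vcl N F Fopt P0 ].
Qed.

Theorem theorem15 (k : int) (hk : 2 <= k) (x : 'cV[int]_2) (n : int) :
  exists F : laurent,
    [/\ n_minimal_representative k n x F,
        n_reduced k n (polynomial_part F)
      & principal_n_reduced k n (principal_part F)].
Proof.
have [N [F [Fopt Flen]]] := optimal_exists k n x.
have [Fx _ _ _] := Fopt; have Vcl := block_closed_represents k x.
exists F; split; first by split.
  exact: optimal_n_reduced hk Vcl Fopt.
have [G GE] := reflection_exists F.
rewrite /principal_n_reduced -(polynomial_part_reflection F G GE).
exact: optimal_n_reduced hk (block_closed_reflection k _ Vcl)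
  (optimal_reflection n _ N F G GE Fopt).
Qed.
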